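(* Let $d\ge 3$ and let the couplings on the edges of the $d$-regular tree be i.i.d. with a symmetric continuous distribution whose support is all of $\mathbb{R}$. Then for almost every realization of the couplings there are infinitely many ground state pairs (GSPs).
   Context: Given couplings $\mathcal{J}=(J_{xy})$ on the edges of a graph $G$, a configuration $\sigma\in\{-1,1\}^{V(G)}$ is a ground state if for every finite set $C$ of vertices $-\sum_{\langle x,y\rangle\in\partial C}J_{xy}\sigma_x\sigma_y\le 0$, where $\partial C$ is the set of edges connecting $C$ to its complement (the energy $-\sum J_{xy}\sigma_x\sigma_y$ cannot be lowered by flipping a finite set of spins). If $\sigma$ is a ground state so is $-\sigma$; the pair $\{\sigma,-\sigma\}$ is a ground state pair (GSP). *)

(* Defs.v *)
From HB Require Import structures.
From mathcomp Require Import all_boot all_order all_algebra finmap.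
From mathcomp Require Import all_classical all_reals all_analysis.
Set Implicit Arguments.
Unset Strict Implicit.
Unset Printing Implicit Defensive.
Import Order.TTheory GRing.Theory Num.Theory.
Import numFieldNormedType.Exports.
Local Open Scope classical_set_scope.
Local Open Scope ring_scope.

Section Graphs.
Variable V : choiceType.
Implicit Types adj : rel V.

Definition graph_connected adj : Prop :=
  forall x y : V, exists2 p : seq V, path adj x p & last x p = y.

(* A [ucycle] of size 1 or 2 is a loop or an edge run back and forth, so the
   genuine cycles are those of size at least 3. *)
Definition graph_acyclic adj : Prop :=
  forall p : seq V, ucycle adj p -> (size p < 3)%N.

Record is_tree adj : Prop := IsTree {
  tree_sym : symmetric adj;
  tree_irr : irreflexive adj;
  tree_inhabited : inhabited V;
  tree_connected : graph_connected adj;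
  tree_acyclic : graph_acyclic adj }.

Definition regular (d : nat) adj : Prop :=
  forall x : V, ([set y | adj x y] #= `I_d)%card.

Definition edge adj : choiceType :=
  {e : {fset V} | `[< exists x y : V, adj x y /\ e = [fset x; y]%fset >]}.

Definition edge_boundary adj (C : {fset V}) : set (edge adj) :=
  [set e | exists x y : V,
    [/\ val e = [fset x; y]%fset, x \in C & y \notin C]].

End Graphs.

Section GroundStates.
Variables (R : realType) (V : choiceType) (adj : rel V).
Implicit Types (j : edge adj -> R) (s : V -> R).

Definition configuration s : Prop := forall x : V, s x = 1 \/ s x = -1.

(* For an edge [e] with endpoints [x] and [y], the product
   [\prod_(x <- val e) s x] is [s x * s y].  When the graph is locally finite,
   the boundary of [C] is finite, so that the finitely supported sum below is
   the genuine sum over the boundary. *)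
Definition ground_state j s : Prop :=
  configuration s /\
  forall C : {fset V},
    - (\sum_(e \in edge_boundary C) j e * \prod_(x <- val e) s x) <= 0.

Definition ground_state_pairs j : set (set (V -> R)) :=
  [set [set s; (fun x => - s x)] | s in [set s | ground_state j s]].

End GroundStates.

Section Laws.
Variable R : realType.
Implicit Type mu : probability (measurableTypeR R) R.

Definition symmetric_law mu : Prop :=
  forall A : set R, measurable A -> mu (-%R @^-1` A) = mu A.

(* Continuity of the cumulative distribution function. *)
Definition continuous_law mu : Prop :=
  continuous (fun r : R => mu `]-oo, r]%classic).

Definition law_support mu : set R :=
  [set x | forall U : set R, open U -> U x -> (0 < mu U)%E].

Variables (dT : measure_display) (T : measurableType dT) (P : probability T R).

Definition mutually_independent (I : choiceType) (X : I -> {RV P >-> R}) : Prop :=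
  forall (F : {fset I}) (A : I -> set R), (forall i, measurable (A i)) ->
    P (\bigcap_(i in [set` F]) (X i @^-1` A i)) =
    (\prod_(i <- F) P (X i @^-1` A i))%E.

Definition iid_with_law (I : choiceType) (X : I -> {RV P >-> R}) mu : Prop :=
  mutually_independent X /\
  forall (i : I) (A : set R), measurable A -> distribution P (X i) A = mu A.

End Laws.

(* Main.v *)
Require Import Defs.
From HB Require Import structures.
From mathcomp Require Import all_boot all_order all_algebra finmap.
From mathcomp Require Import all_classical all_reals all_analysis.
From mathcomp Require Import ring lra.
Import Order.TTheory GRing.Theory Num.Theory.
Import numFieldNormedType.Exports.
Local Open Scope classical_set_scope.
Local Open Scope ring_scope.

(** Call an edge [e] open when [a <= |J_e|], where [a > 0] is so small that edges
are open with probability in [[3/4, 1)]. A configuration whose only unsatisfied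
edge is a closed edge [e] is a ground state as soon as both endpoints of [e]
start an infinite open path avoiding [e]: a finite set with [e] in its boundary
contains an endpoint of [e], the open path leaves it, and the satisfied open
edge where it does so outweighs [e]. In a binary subtree an open ray starts at
a given vertex with probability at least [1/2], and along a ray of the tree one
finds infinitely many disjoint branches in which such a closed edge exists
independently with a fixed positive probability. Almost surely infinitely many
of these closed edges occur, and distinct edges give distinct ground state
pairs. *)

Set Implicit Arguments.
Unset Strict Implicit.

(** * Trees *)

Fixpoint nonbacktracking {V : eqType} (p : seq V) : bool :=
  if p is x :: p' then
    (if p' is _ :: z :: _ then x != z else true) && nonbacktracking p'
  else true.

Lemma edge_of_adj (V : choiceType) (adj : rel V) x y : adj x y ->
  exists e : edge adj, val e = [fset x; y]%fset.
Proof.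
move=> xy.
have h : `[< exists x' y', adj x' y' /\ [fset x; y]%fset = [fset x'; y']%fset >].
  by apply/asboolP; exists x, y.
by exists (exist (fun e : {fset V} =>
  `[< exists x y : V, adj x y /\ e = [fset x; y]%fset >]) _ h).
Qed.

Section Tree.
Variables (V : choiceType) (adj : rel V).
Hypothesis adj_tree : is_tree adj.

Lemma tree_closed_walk x p :
  path adj x (rcons p x) -> uniq (x :: p) -> exists y, p = [:: y].
Proof.
move=> xpx up; have := tree_acyclic adj_tree (introT andP (conj xpx up)).
case: p xpx up => [|y [|z p]] //=; first by rewrite tree_irr.
by exists y.
Qed.

(** At a first return to [x], the walk cut there is closed and without repetition, hence runs along
    one edge and back, which is a backtrack. *)
Lemma nonbacktracking_uniq x p :
  path adj x p -> nonbacktracking (x :: p) -> uniq (x :: p).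
Proof.
elim: p x => // y p IH x /andP[xy yp] nb.
have uyp : uniq (y :: p) by apply: IH => //; case/andP: nb.
rewrite cons_uniq uyp andbT; apply/negP => xyp.
have : path adj x (y :: p) by rewrite /= xy.
move: uyp nb; case/splitPr: (y :: p) / xyp => p1 p2.
rewrite -cat_rcons cat_path cat_uniq rcons_uniq.
move=> /andP[/andP[xp1 up1] _] nb /andP[xp1x _].
have [||z p1E] := @tree_closed_walk x p1 => //; first by rewrite /= xp1.
by move: nb; rewrite p1E /= eqxx.
Qed.

(** * Edge signs on a tree as products of vertex signs *)

Section Gauge.
Variables (R : idomainType) (s : V -> V -> R).
Hypothesis s_sym : forall x y, s x y = s y x.
Hypothesis s_sign : forall x y, s x y = 1 \/ s x y = -1.

Fixpoint walk_sign (x : V) (p : seq V) : R :=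
  if p is y :: p' then s x y * walk_sign y p' else 1.

Lemma walk_sign_cat x p q :
  walk_sign x (p ++ q) = walk_sign x p * walk_sign (last x p) q.
Proof. by elim: p x => [|y p IH] x /=; rewrite ?mul1r// IH mulrA. Qed.

Lemma sqr_sign x y : s x y * s x y = 1.
Proof. by case: (s_sign x y) => ->; rewrite ?mulrNN mulr1. Qed.

Lemma walk_sign_sign x p : walk_sign x p = 1 \/ walk_sign x p = -1.
Proof.
elim: p x => [|y p IH] x /=; first by left.
case: (s_sign x y) => ->; case: (IH y) => ->; rewrite ?mulrNN ?mulr1 ?mul1r;
  by [left|right].
Qed.

(* Loops can be cut off a walk because the only closed walks without repetition
   run back and forth along an edge, and those have sign [1]. *)
Lemma walk_sign_uniq x p : path adj x p ->
  exists q, [/\ path adj x q, last x q = last x p, uniq (x :: q) &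
             walk_sign x q = walk_sign x p].
Proof.
elim: p x => [|y p IH] x /=; first by exists [::].
move=> /andP[xy /IH[q [yq ql uq qs]]].
have [xq|xq] := boolP (x \in y :: q); last first.
  by exists (y :: q); split; rewrite /= ?xy ?qs//; move: uq xq => /= -> ->.
have : path adj x (y :: q) by rewrite /= xy.
rewrite -qs -ql -[s x y * _]/(walk_sign x (y :: q)).
rewrite -[last y q]/(last x (y :: q)); move: uq; case/splitPr: (y :: q) / xq.
move=> p1 p2; rewrite -cat_rcons cat_path cat_uniq rcons_uniq last_rcons.
move=> /and3P[/andP[xp1 up1] hp2 up2] /andP[xp1x xp2].
exists p2; split=> //; first by rewrite last_cat last_rcons.
  rewrite /= up2 andbT; apply: contra hp2 => xp2'; apply/hasP; exists x => //.
  by rewrite /= mem_rcons mem_head.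
have [||z p1E] := @tree_closed_walk x p1 => //; first by rewrite /= xp1.
by rewrite walk_sign_cat last_rcons p1E /= mulr1 (s_sym z x) sqr_sign mul1r.
Qed.

Lemma walk_sign_closed x p :
  path adj x p -> last x p = x -> walk_sign x p = 1.
Proof.
move=> /walk_sign_uniq[q [_ <- uq <-]] ql.
case: q uq ql => // y q; rewrite cons_uniq => /andP[+ _] /= ql.
by rewrite -{1}ql mem_last.
Qed.

(** The sign of [x] is the product of [s] along a walk from a root to [x]; closed walks have sign
    [1], so the choice of walk does not matter. *)
Lemma tree_gauge : exists sg : V -> R,
  (forall x, sg x = 1 \/ sg x = -1) /\
  (forall x y, adj x y -> sg x * sg y = s x y).
Proof.
have [root] := tree_inhabited adj_tree.
have /choice [p pP] : forall x, exists p, path adj root p /\ last root p = x.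
  by move=> x; have [p] := tree_connected adj_tree root x; exists p.
exists (fun x => walk_sign root (p x)); split=> [x|x y xy].
  exact: walk_sign_sign.
have [[px pxl] [py pyl]] := (pP x, pP y).
have [q yq ql] := tree_connected adj_tree y root.
(* Both walks from [root] to [y] are closed up by the same walk [q], whose nonzero sign then
   cancels. *)
have E : walk_sign root (rcons (p x) y) = walk_sign root (p y).
  have := @walk_sign_closed root (rcons (p x) y ++ q).
  rewrite cat_path rcons_path px pxl last_rcons xy yq last_cat last_rcons.
  move=> /(_ isT ql); rewrite walk_sign_cat last_rcons => E1.
  have := @walk_sign_closed root (p y ++ q).
  rewrite cat_path py pyl yq last_cat pyl => /(_ isT ql).
  rewrite walk_sign_cat pyl -E1 => /mulIf -> //.
  by case: (walk_sign_sign y q) => ->; rewrite ?oppr_eq0 oner_eq0.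
rewrite -E -cats1 walk_sign_cat pxl /= mulr1 mulrA.
by case: (walk_sign_sign root (p x)) => ->; rewrite ?mulrNN !mul1r.
Qed.

End Gauge.

(* Gauging the sign that is [-1] on the edge [xy] only gives the two sides of
   that edge. *)
Lemma tree_cut x y : adj x y -> exists chi : V -> bool,
  chi x <> chi y /\
  forall u w, adj u w -> x \notin [:: u; w] \/ y \notin [:: u; w] ->
    chi u = chi w.
Proof.
move=> xy.
pose s u w : int := if [fset u; w]%fset == [fset x; y]%fset then -1 else 1.
have [||sg [sgn sgE]] := @tree_gauge _ s.
- by move=> u w; rewrite /s fsetUC.
- by move=> u w; rewrite /s; case: ifP => _; [right|left].
exists (fun u => sg u == 1); split.
  move: (sgE _ _ xy); rewrite /s eqxx.
  by case: (sgn x) => ->; case: (sgn y) => ->.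
move=> u w uw E.
have : sg u * sg w = 1.
  rewrite sgE // /s ifF //; apply/negP => /eqP/fsetP F.
  by case: E; rewrite !inE => /negP; apply; [have := F x|have := F y];
    rewrite !inE eqxx ?orbT.
by case: (sgn u) => ->; case: (sgn w) => ->.
Qed.

(** A walk avoiding one endpoint of the cut edge never crosses it. Only one endpoint is mentioned,
    so that either one can play the part of [x]. *)
Lemma cut_path (chi : V -> bool) x :
  (forall u w, adj u w -> x \notin [:: u; w] -> chi u = chi w) ->
  forall z p, path adj z p -> x \notin z :: p -> chi (last z p) = chi z.
Proof.
move=> chiE z p; elim: p z => //= y p IH z /andP[zy yp] xzyp.
rewrite IH //; last by move: xzyp; rewrite !inE => /norP[_].
by apply/esym/chiE => //; move: xzyp; rewrite !inE !negb_or => /and3P[-> ->].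
Qed.

End Tree.

(** * A binary tree inside the regular tree *)

Section BinarySubtree.
Variables (V : choiceType) (adj : rel V) (d : nat).
Hypotheses (adj_tree : is_tree adj) (d_ge3 : (3 <= d)%N).
Hypothesis adj_regular : regular d adj.

(** Here [q] is a vertex preceded by its parent. Among three distinct neighbours at most one is the
    parent, so two remain. *)
Lemma two_children (q : V * V) : exists h : bool -> V,
  [/\ forall b, adj q.2 (h b), forall b, h b != q.1 & h true != h false].
Proof.
have := adj_regular q.2; rewrite card_eq_sym => /card_bijP [f /bij_inj finj].
have I i : (i < 3)%N -> `I_d i by move=> i3; exact: leq_trans d_ge3.
pose e i (i3 : (i < 3)%N) := val (f (SigSub (mem_set (I i i3)))).
have eadj i i3 : adj q.2 (@e i i3) by have := set_valP (f (SigSub (mem_set (I i i3)))).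
have eneq i j i3 j3 : i != j -> @e i i3 != @e j j3.
  by apply: contra => /eqP/val_inj/finj/(congr1 val)/= ->.
have H i j i3 j3 : i != j -> @e i i3 != q.1 -> @e j j3 != q.1 ->
    exists h : bool -> V,
  [/\ forall b, adj q.2 (h b), forall b, h b != q.1 & h true != h false].
  move=> ij fi fj; exists (fun b => if b then e i i3 else e j j3).
  by split=> [[]|[]|] //; exact: eneq.
have [e0|e0] := eqVneq (e 0%N isT) q.1.
  by apply: (H 1%N 2%N isT isT) => //; rewrite -e0; exact: eneq.
have [e1|e1] := eqVneq (e 1%N isT) q.1; last exact: (H 0%N 1%N isT isT).
by apply: (H 0%N 2%N isT isT) => //; rewrite -e1; exact: eneq.
Qed.

(** Words grow at the head, so the comparison runs from the last letter, the first step away from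
    the root. *)
Lemma seq_bool_branch (s t : seq bool) :
  [\/ s = t, exists u b, s = u ++ b :: t, exists u b, t = u ++ b :: s |
   exists u u' b r, s = u ++ b :: r /\ t = u' ++ ~~ b :: r].
Proof.
elim/last_ind: s t => [|s x IH] t; case/lastP: t => [|t y].
- exact: Or41.
- by apply: Or43; exists t, y; rewrite cats1.
- by apply: Or42; exists s, x; rewrite cats1.
have [->|xy] := eqVneq x y.
  case: (IH t) => [->|[u [b ->]]|[u [b ->]]|[u [u' [b [r [-> ->]]]]]].
  + exact: Or41.
  + by apply: Or42; exists u, b; rewrite rcons_cat.
  + by apply: Or43; exists u, b; rewrite rcons_cat.
  + by apply: Or44; exists u, u', b, (rcons r y); rewrite !rcons_cat.
apply: Or44; exists s, t, x, [::]; rewrite !cats1; split=> //.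
by case: x y xy => [] [].
Qed.

Lemma binary_subtree : exists v : seq bool -> V,
  injective v /\ forall b s, adj (v s) (v (b :: s)).
Proof.
have [root] := tree_inhabited adj_tree.
have /choice [ch chP] := two_children.
(* The parent is carried along with the vertex; the root stands in for its own parent. *)
pose fix g (s : seq bool) : V * V :=
  if s is b :: s' then ((g s').2, ch (g s') b) else (root, root).
pose v s := (g s).2; exists v.
have vadj b s : adj (v s) (v (b :: s)) by have [/(_ b)] := chP (g s).
have vback c b s : v (c :: b :: s) != v s.
  by have [_ /(_ c)] := chP (v s, ch (g s) b).
have vsib b s : v (b :: s) != v (~~ b :: s).
  by have [_ _] := chP (g s); case: b => //=; rewrite eq_sym.
pose fix climb (u t : seq bool) {struct u} : seq V :=
  if u is c :: u' then v (u' ++ t) :: climb u' t else [::].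
have climb_path u t : path adj (v (u ++ t)) (climb u t).
  by elim: u => //= c u ->; rewrite (tree_sym adj_tree) vadj.
have climb_last u t : last (v (u ++ t)) (climb u t) = v t.
  by elim: u => //= c u ->.
(* The walk climbs to [v (b :: r)], then to [v r], and descends to the sibling. It never backtracks,
   hence never repeats a vertex. *)
have uniq_walk u b r :
    uniq (v (u ++ b :: r) :: climb u (b :: r) ++ [:: v r; v (~~ b :: r)]).
  apply: (nonbacktracking_uniq adj_tree).
    rewrite cat_path climb_path climb_last /= vadj.
    by rewrite (tree_sym adj_tree) vadj.
  elim: u => [|c [|c' u] IH]; first by rewrite /= vsib.
    by rewrite /= vback vsib.
  by apply/andP; split; [exact: vback | exact: IH].
split=> // s t.
(* Cutting the edge from [v r] to [v (b :: r)] separates the subtree of [b :: r] from [v r] and from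
   the sibling subtree: the climbs inside each side miss the opposite endpoint. *)
have side u b r : exists chi : V -> bool, [/\ chi (v r) <> chi (v (b :: r)),
    chi (v (u ++ b :: r)) = chi (v (b :: r)) &
    forall u', chi (v (u' ++ ~~ b :: r)) = chi (v r)].
  have [chi [chi1 chi2]] := tree_cut adj_tree (vadj b r).
  exists chi; split=> //.
    have := uniq_walk u b r; rewrite -cat_cons cat_uniq => /and3P[_ + _].
    rewrite /= => /norP[h _]; rewrite -[in RHS](climb_last u).
    apply/esym; apply: (@cut_path _ adj _ (v r)) => // x y xy hx.
    by apply: chi2 => //; left.
  move=> u'; have := uniq_walk u' (~~ b) r; rewrite negbK.
  rewrite -[[:: v r; _]]cat1s catA -cat_cons cat_uniq => /and3P[_ + _].
  rewrite /= orbF => h.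
  have -> : v r = last (v (u' ++ ~~ b :: r)) (climb u' (~~ b :: r) ++ [:: v r]).
    by rewrite last_cat.
  apply/esym; apply: (@cut_path _ adj _ (v (b :: r))) => //.
    by move=> x y xy hx; apply: chi2 => //; right.
  by rewrite cat_path climb_path climb_last /= (tree_sym adj_tree) vadj.
case: (seq_bool_branch s t) => // [[u [b ->]]|[u [b ->]]|].
- by have [chi [h1 h2 _]] := side u b t => E; case: h1; rewrite -h2 E.
- by have [chi [h1 h2 _]] := side u b s => E; case: h1; rewrite -h2 E.
- move=> [u [u' [b [r [-> ->]]]]] E.
  by have [chi [h1 h2 h3]] := side u b r; case: h1; rewrite -h2 E h3.
Qed.

(* The vertices are the [v (rcons s true)] of [binary_subtree], so that even the
   empty word has a parent edge and [ve] is injective on all words. *)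
Lemma binary_subtree_edges :
  exists (v : seq bool -> V) (ve : seq bool -> edge adj),
  [/\ injective v, injective ve, forall b s, adj (v s) (v (b :: s)) &
      forall b s, val (ve (b :: s)) = [fset v s; v (b :: s)]%fset].
Proof.
have [v [vinj vadj]] := binary_subtree.
have edgeP (s : seq bool) :
    exists e : edge adj, val e = [fset v (behead (rcons s true)); v (rcons s true)]%fset.
  by apply: edge_of_adj; case: s => [|b s]; exact: vadj.
have [ve veE] := choice edgeP.
exists (fun s => v (rcons s true)), ve; split.
- by move=> s t /vinj/rcons_inj[].
(* Matching the endpoints crosswise would make a word two letters longer than itself. *)
- have H b s c t : [fset v s; v (b :: s)]%fset = [fset v t; v (c :: t)]%fset ->
      b :: s = c :: t.
    move=> /fsetP E; have := E (v (b :: s)).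
    rewrite !inE eqxx orbT => /esym/orP[]/eqP/vinj //.
    move=> tE; have := E (v (c :: t)); rewrite !inE eqxx orbT => /orP[]/eqP/vinj.
      move/(congr1 size); rewrite -tE /= => /eqP.
      by rewrite -addn2 -{2}[size s]addn0 eqn_add2l.
    by [].
  move=> s t /(congr1 val); rewrite !veE.
  have consE (q : seq bool) : exists b q', rcons q true = b :: q'.
    by case: q => [|b q]; [exists true, [::]|exists b, (rcons q true)].
  have [[b [s' sE]] [c [t' tE]]] := (consE s, consE t).
  rewrite sE tE /= => /H; rewrite -sE -tE => /rcons_inj[] //.
- by move=> b s; exact: vadj.
- by move=> b s; rewrite veE.
Qed.

End BinarySubtree.

(** * Ground states with one unsatisfied edge *)

Lemma edge_adj (V : choiceType) (adj : rel V) (e : edge adj) :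
  exists x y, adj x y /\ val e = [fset x; y]%fset.
Proof. by have /asboolP := valP e. Qed.

(** A word in [op] stands for the open edge joining it to its parent. An infinite open path is
    encoded as open descents of every finite length. *)
Fixpoint reaches (op : set (seq bool)) (n : nat) (t : seq bool) : Prop :=
  if n is n'.+1 then exists b, op (b :: t) /\ reaches op n' (b :: t) else True.

(** Otherwise the open descents from [u] stay in [C] and give arbitrarily long words there, while
    [C] is finite and [v] injective. *)
Lemma reaches_exit (V : choiceType) (v : seq bool -> V) (C : {fset V}) op u :
  injective v -> v u \in C -> (forall n, reaches op n u) ->
  exists b s, [/\ op (b :: s), v s \in C & v (b :: s) \notin C].
Proof.
move=> vinj uC ru; apply: contrapT => noexit.
have step b s : op (b :: s) -> v s \in C -> v (b :: s) \in C.
  move=> bs sC; apply: contrapT => /negP bsC; apply: noexit.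
  by exists b, s.
have deep n w : v w \in C -> reaches op n w ->
    exists s, size s = (n + size w)%N /\ v s \in C.
  elim: n w => [|n IH] w wC /=; first by exists w.
  case=> b [/step/(_ wC) bC /(IH _ bC)[s [sE sC]]].
  by exists s; rewrite sE /= addnS.
(* The greatest length of a word with vertex in [C]; vertices outside the image of [v] count as the
   empty word. *)
pose N := \max_(x <- C) size (xget [::] [set s | v s = x]).
have [s [sE sC]] := deep N.+1 u uC (ru N.+1).
suff : (size s <= N)%N by rewrite sE addSn ltnNge leq_addr.
have vE : xget [::] [set s' | v s' = v s] = s.
  by apply: vinj; exact: (@xgetPex _ _ [set s' | v s' = v s] (ex_intro _ s erefl)).
by rewrite -[in X in (X <= _)%N]vE; apply: (leq_bigmax_seq (v s)).
Qed.

Section GroundStates.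
Variables (R : realType) (V : choiceType) (adj : rel V).
Hypothesis adj_tree : is_tree adj.
Variable j : edge adj -> R.

Definition unsatisfied_only (e0 : edge adj) (s : V -> R) : Prop :=
  forall x y (e : edge adj), val e = [fset x; y]%fset -> adj x y ->
    s x * s y = (-1) ^+ (j e < 0)%R * (-1) ^+ (e == e0).

Lemma unsatisfied_only_exists e0 :
  exists s, configuration s /\ unsatisfied_only e0 s.
Proof.
pose sg e : R := (-1) ^+ (j e < 0)%R * (-1) ^+ (e == e0).
(* The gauge lemma needs a sign for every pair of vertices; pairs that are not edges get [1]. *)
pose s x y : R := if pselect (exists e : edge adj, val e = [fset x; y]%fset)
  is left h then sg (projT1 (cid h)) else 1.
have sE x y (e : edge adj) : val e = [fset x; y]%fset -> s x y = sg e.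
  move=> exy; rewrite /s; case: pselect => [h|[]]; last by exists e.
  by congr sg; apply: val_inj; rewrite exy; case: cid.
have [||sig [sig1 sigE]] := @tree_gauge _ _ adj_tree _ s.
- by move=> x y; rewrite /s fsetUC.
- move=> x y; rewrite /s; case: pselect => h; last by left.
  rewrite /sg; case: (_ < _); case: (_ == _); rewrite ?mulrNN ?mulr1 ?mul1r;
    by [left|right].
exists sig; split=> // x y e exy xy.
by rewrite sigE // (sE _ _ _ exy).
Qed.

Lemma prod_edge (s : V -> R) x y (e : edge adj) : val e = [fset x; y]%fset ->
  adj x y -> \prod_(z <- val e) s z = s x * s y.
Proof.
move=> -> xy; rewrite big_fsetU1 ?big_seq_fset1 //= inE.
by apply: contraTN xy => /eqP ->; rewrite (tree_irr adj_tree).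
Qed.

(** Every boundary edge contributes its absolute coupling, except [e0], which contributes the
    negative; the heavier edge compensates for it. *)
Lemma unsatisfied_only_ground_state e0 s : configuration s ->
  unsatisfied_only e0 s ->
  (forall C : {fset V}, edge_boundary C e0 ->
    exists2 e, edge_boundary C e & (e != e0) && (`|j e0| < `|j e|)) ->
  ground_state j s.
Proof.
move=> conf uns cutC; split=> // C; rewrite oppr_le0.
have FE e : j e * \prod_(x <- val e) s x = if e == e0 then - `|j e| else `|j e|.
  have [x [y [xy exy]]] := edge_adj e.
  rewrite (prod_edge _ exy) // (uns _ _ _ exy) // mulrA [j e * _]mulrC.
  by rewrite -normrEsign; case: (e == e0); rewrite ?mulrN1 ?mulr1.
under eq_fun do rewrite FE; under eq_bigr do rewrite FE.
(* The sum is [0] by convention when infinitely many terms are nonzero. *)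
case: finite_supportP => [|X XC XF _]; first by rewrite big_nil.
have [e0C|e0C] := boolP (e0 \in X); last first.
  rewrite big_seq; apply: sumr_ge0 => e eX; case: eqP eX => // ->.
  by rewrite (negbTE e0C).
have [e eC /andP[ne lt]] := cutC C (XC _ e0C).
(* Outside the support the term of [e] would be [0], which cannot exceed an absolute value. *)
have eX : e \in X.
  apply: contraLR lt => /(XF _ eC); rewrite (negbTE ne) => ->.
  by rewrite -leNgt.
rewrite (bigD1_seq e0) //= eqxx addrC subr_ge0 -big_filter.
rewrite (bigD1_seq e) ?filter_uniq ?mem_filter ?ne //= (negbTE ne).
rewrite (le_trans (ltW lt)) // lerDl big_filter_cond.
by apply: sumr_ge0 => f /andP[/negbTE ->].
Qed.

(** The product of the two spins on [e k] is the same for both members of a pair, and it tells the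
    pair of [k] from that of any other [l], where [e k] is satisfied. *)
Lemma infinite_ground_state_pairs (K : set nat) (e : nat -> edge adj) :
  infinite_set K -> injective e ->
  (forall k, K k -> exists2 s, ground_state j s & unsatisfied_only (e k) s) ->
  infinite_set (ground_state_pairs j).
Proof.
move=> Kinf einj sP finG; apply: Kinf.
have /choice [s {}sP] : forall k, exists s, K k ->
    ground_state j s /\ unsatisfied_only (e k) s.
  move=> k; have [Kk|nKk] := pselect (K k); last by exists (fun=> 0).
  by have [s] := sP k Kk; exists s.
pose G k : set (V -> R) := [set s k; (fun x => - s k x)].
have Ginj : {in K &, injective G}.
  move=> k l /set_mem Kk /set_mem Kl Gkl; apply: einj.
  have [x [y [xy exy]]] := edge_adj (e k).
  have skl : s k x * s k y = s l x * s l y.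
    have : G k (s k) by left.
    by rewrite Gkl => -[->|->] //; rewrite mulrNN.
  have [_ /(_ x y _ exy xy)] := sP k Kk.
  have [_ /(_ x y _ exy xy)] := sP l Kl.
  rewrite skl => ->; rewrite eqxx; case: eqP => // _.
  rewrite mulr1 mulrN1 => /eqP.
  by rewrite -subr_eq0 opprK -mulr2n mulrn_eq0 signr_eq0.
have : finite_set (G @` K).
  apply: sub_finite_set finG => _ [k Kk <-]; exists (s k) => //.
  by have [] := sP k Kk.
by rewrite (eq_finite_set (inj_card_eq Ginj)).
Qed.

End GroundStates.

(** * Independence of generated sigma-algebras *)

Section RealProbability.
Variables (R : realType) (dT : measure_display) (T : measurableType dT).
Variable P : probability T R.

Definition pr (E : set T) : R := fine (P E).

Lemma prE E : measurable E -> P E = (pr E)%:E.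
Proof. by move=> mE; rewrite fineK // fin_num_measure. Qed.

Lemma pr_ge0 E : 0 <= pr E.
Proof. by rewrite fine_ge0. Qed.

Lemma pr_le1 E : measurable E -> pr E <= 1.
Proof. by move=> mE; rewrite -lee_fin -prE // probability_le1. Qed.

Lemma pr_le E F : measurable E -> measurable F -> E `<=` F -> pr E <= pr F.
Proof. by move=> mE mF EF; rewrite -lee_fin -!prE // le_measure ?inE. Qed.

Lemma prC E : measurable E -> pr (~` E) = 1 - pr E.
Proof.
by move=> mE; rewrite /pr probability_setC // fineB // fin_num_measure.
Qed.

(** [P] restricted to [C] and [P] scaled by [pr C] are finite measures agreeing on the pi-system [G]
    and on the whole space, hence on the sigma-algebra generated by [G]. *)
Lemma indep_generated (G : set (set T)) (C : set T) :
  measurable C -> setI_closed G -> G `<=` measurable ->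
  (forall A, G A -> pr (A `&` C) = pr A * pr C) ->
  forall A, <<s G >> A -> pr (A `&` C) = pr A * pr C.
Proof.
move=> mC GI Gm GC A GA.
have mA : measurable A.
  apply: GA; split=> //; exact: sigma_algebra_measurable.
pose c := NngNum (pr_ge0 C).
pose m1 : {measure set T -> \bar R} := mrestr P mC.
pose m2 : {measure set T -> \bar R} := mscale c P.
have m1E B : measurable B -> m1 B = (pr (B `&` C))%:E.
  by move=> mB; rewrite -prE //; exact: measurableI.
have m2E B : measurable B -> m2 B = (pr C * pr B)%:E.
  by move=> mB; rewrite EFinM -(prE mB).
suff : m1 A = m2 A by rewrite m1E // m2E // => -[->]; rewrite mulrC.
have m12 B : measurable B -> pr (B `&` C) = pr B * pr C -> m1 B = m2 B.
  by move=> mB BC; rewrite m1E // m2E // BC mulrC.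
apply: (g_sigma_algebra_measure_unique_trace G setT) => //.
- by move=> B [/Gm].
- by move=> B B' [GB _] [GB' _]; split=> //; exact: GI.
- by apply: m12 => //; rewrite setTI [pr setT]/pr probability_setT mul1r.
- by move=> B [GB _]; apply: m12; [exact: Gm|exact: GC].
- by rewrite /m1 /mrestr /= ltey_eq fin_num_measure // setTI.
- by apply: sub_sigma_algebra2 GA => B.
Qed.

Section IndependentFamily.
Variables (I : choiceType) (B : I -> set T).
Hypothesis mB : forall i, measurable (B i).
Hypothesis B_indep : forall S : {fset I},
  pr (\bigcap_(i in [set` S]) B i) = \prod_(i <- S) pr (B i).

Definition cylinders (F : set I) : set (set T) :=
  [set E | exists2 S : {fset I}, [set` S] `<=` F &
                                 E = \bigcap_(i in [set` S]) B i].

Definition sigma (F : set I) : set (set T) := <<s cylinders F >>.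

Lemma cylindersI F : setI_closed (cylinders F).
Proof.
move=> _ _ [S SF ->] [S' S'F ->]; exists (S `|` S')%fset.
  by rewrite set_fsetU => i [/SF|/S'F].
by rewrite set_fsetU bigcap_setU.
Qed.

Lemma cylinders_measurable F : cylinders F `<=` measurable.
Proof.
by move=> _ [S _ ->]; apply: fin_bigcap_measurable => //; exact: finite_fset.
Qed.

Lemma sigma_measurable F E : sigma F E -> measurable E.
Proof.
apply; split; first exact: sigma_algebra_measurable.
exact: cylinders_measurable.
Qed.

Lemma sigma_base F i : F i -> sigma F (B i).
Proof.
move=> Fi; apply: sub_sigma_algebra; exists [fset i]%fset.
  by move=> k /=; rewrite inE => /eqP ->.
by rewrite set_fset1 bigcap_set1.
Qed.

Lemma sigmaS F F' E : sigma F E -> F `<=` F' -> sigma F' E.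
Proof.
move=> FE FF'; move: FE; apply: sub_sigma_algebra2 => _ [S SF ->]; exists S => //.
exact: subset_trans FF'.
Qed.

Lemma sigmaC F E : sigma F E -> sigma F (~` E).
Proof. exact: sigma_algebraC. Qed.

Lemma sigma_bigcap F (E : nat -> set T) :
  (forall n, sigma F (E n)) -> sigma F (\bigcap_n E n).
Proof.
move=> FE; rewrite -[X in sigma F X]setCK setC_bigcap; apply: sigmaC.
by apply: sigma_algebra_bigcup => n; exact: sigmaC.
Qed.

Lemma sigmaI F E E' : sigma F E -> sigma F E' -> sigma F (E `&` E').
Proof.
move=> FE FE'; rewrite -bigcap2E; apply: sigma_bigcap => -[|[|n]] //=.
rewrite -setC0; apply: sigmaC; exact: sigma_algebra0.
Qed.

(** Two applications of [indep_generated], one per event, reduce to cylinders, whose disjoint index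
    sets make the product formula split. *)
Lemma sigma_indep F F' E E' : (forall i, F i -> F' i -> False) ->
  sigma F E -> sigma F' E' -> pr (E `&` E') = pr E * pr E'.
Proof.
move=> FF' FE; rewrite setIC mulrC; move: E'.
have mE := sigma_measurable FE.
apply: indep_generated => //; first exact: cylindersI.
  exact: cylinders_measurable.
move=> E' cE'; rewrite setIC mulrC; move: E FE {mE}.
apply: indep_generated; [|exact: cylindersI|exact: cylinders_measurable|].
  exact: cylinders_measurable cE'.
move: cE' => [S' S'F ->] _ [S SF ->].
rewrite -bigcap_setU -set_fsetU !B_indep -big_cat.
apply: perm_big; apply: uniq_perm; first exact: fset_uniq.
  rewrite cat_uniq !fset_uniq andbT /=; apply/hasPn => i iS'.
  apply/negP => iS; exact: (FF' i (SF _ iS) (S'F _ iS')).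
by move=> i; rewrite mem_cat in_fsetU.
Qed.

End IndependentFamily.

End RealProbability.

Unset Implicit Arguments.
Set Strict Implicit.

(** * Percolation on the binary tree *)

Section BinaryPercolation.
Variables (R : realType) (dT : measure_display) (T : measurableType dT).
Variables (P : probability T R) (B : seq bool -> set T) (q : R).
Hypothesis mB : forall i, measurable (B i).
Hypothesis B_indep : forall S : {fset seq bool},
  pr P (\bigcap_(i in [set` S]) B i) = \prod_(i <- S) pr P (B i).
Hypothesis prB : forall s, pr P (B s) = q.
Hypotheses (q_ge : 3 / 4 <= q) (q_lt1 : q < 1).

Let sm := sigma_measurable mB.

Definition subtree (t : seq bool) : set (seq bool) :=
  [set s | exists u, s = u ++ t].

(** Strict descendants only, so that what happens below [t] is independent of [B t]. *)
Definition below (t : seq bool) : set (seq bool) :=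
  [set s | exists u b, s = u ++ b :: t].

Lemma subtree_disjoint b t s :
  subtree (b :: t) s -> subtree (~~ b :: t) s -> False.
Proof.
move=> [u ->] [u' /(congr1 rev)]; rewrite !rev_cat !rev_cons !cat_rcons => /eqP.
by rewrite eqseq_cat // => /andP[_]; rewrite eqseq_cons; case: b.
Qed.

Lemma below_subtree b t : subtree (b :: t) `<=` below t.
Proof. by move=> s [u ->]; exists u, b. Qed.

Lemma self_notin_below t : below t t -> False.
Proof.
move=> [u [b /(congr1 size)]]; rewrite size_cat /= -[LHS]add0n addnS -addSn => /eqP.
by rewrite eqn_add2r.
Qed.

Definition reach n t : set T := [set w | reaches (fun s => B s w) n t].

Lemma reach0 t : reach 0 t = setT.
Proof. by apply/seteqP; split=> w. Qed.

(** Complements turn the choice of a child into an intersection of events on disjoint subtrees,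
    ready for independence. *)
Lemma reachS n t : ~` reach n.+1 t =
  ~` (B (true :: t) `&` reach n (true :: t)) `&`
  ~` (B (false :: t) `&` reach n (false :: t)).
Proof.
rewrite -setCU; congr (~` _); apply/seteqP; split=> w /=.
  by move=> [[] ?]; [left|right].
by move=> [?|?]; [exists true|exists false].
Qed.

Lemma sigma_reach n t : sigma B (below t) (reach n t).
Proof.
elim: n t => [|n IH] t.
  rewrite reach0 -setC0.
  by apply: sigmaC; exact: sigma_algebra0.
have H b : sigma B (below t) (~` (B (b :: t) `&` reach n (b :: t))).
  apply: sigmaC; apply: sigmaI; first by apply: sigma_base; exists [::], b.
  apply: (sigmaS (IH _)) => s [u [c ->]]; exists (u ++ [:: c]), b.
  by rewrite -catA.
by rewrite -[reach _ _]setCK reachS; apply: sigmaC; apply: sigmaI; exact: H.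
Qed.

Lemma sigma_open_reach n t : sigma B (subtree t) (B t `&` reach n t).
Proof.
apply: sigmaI; first by apply: sigma_base; exists [::].
by apply: (sigmaS (sigma_reach n t)) => s [u [b ->]]; exists (u ++ [:: b]); rewrite -catA.
Qed.

Lemma pr_open_reach n t : pr P (B t `&` reach n t) = q * pr P (reach n t).
Proof.
rewrite -(prB t); apply: (@sigma_indep _ _ _ P _ B mB B_indep [set t] (below t)).
- by move=> s -> /self_notin_below.
- exact: sigma_base.
- exact: sigma_reach.
Qed.

(* The map [x |-> 1 - (1 - q x)^2] giving the probability at depth [n.+1] sends
   [[1/2, 1]] to itself as soon as [3/4 <= q]. *)
Lemma pr_reach_ge n t : 1 / 2 <= pr P (reach n t).
Proof.
elim: n t => [|n IH] t.
  rewrite reach0.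
  by rewrite /pr probability_setT /=; lra.
have mr : measurable (reach n.+1 t) by exact: sm (sigma_reach _ _).
have := prC P mr.
rewrite reachS (@sigma_indep _ _ _ P _ B mB B_indep _ _ _ _
  (@subtree_disjoint true t)); first last.
- by apply: sigmaC; exact: sigma_open_reach.
- by apply: sigmaC; exact: sigma_open_reach.
rewrite !(@prC _ _ _ P); first last.
- exact: sm (sigma_open_reach _ _).
- exact: sm (sigma_open_reach _ _).
rewrite !pr_open_reach; have := IH (true :: t); have := IH (false :: t).
have : pr P (reach n (true :: t)) <= 1 by apply/pr_le1/(sm _ _ (sigma_reach _ _)).
have : pr P (reach n (false :: t)) <= 1 by apply/pr_le1/(sm _ _ (sigma_reach _ _)).
move: (pr P (reach n (true :: t))) (pr P (reach n (false :: t))).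
move=> x y y1 x1 hy hx E.
have [q_ge' q_lt1'] := (q_ge, q_lt1).
have q_mul z : 1 / 2 <= z -> z <= 1 -> 3 / 8 <= q * z /\ q * z <= 1.
  move=> z2 z1; split; last by apply: mulr_ile1; lra.
  have h : 3 / 4 * (1 / 2) <= q * z by apply: ler_pM; lra.
  by lra.
have [[qx qx1] [qy qy1]] := (q_mul x hx x1, q_mul y hy y1).
(* Since [q * x] and [q * y] are at least [3/8]; and [25/64] is below [1/2]. *)
have h : (1 - q * x) * (1 - q * y) <= 5 / 8 * (5 / 8) by apply: ler_pM; lra.
by lra.
Qed.

Definition ray t : set T := \bigcap_n reach n t.

Lemma sigma_ray t : sigma B (below t) (ray t).
Proof. by apply: sigma_bigcap => n; exact: sigma_reach. Qed.

Lemma reach_decr n t : reach n.+1 t `<=` reach n t.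
Proof.
move=> w; rewrite /reach /=; elim: n t => [|n IH] t //= [b [bo r]].
by exists b; split=> //; exact: IH.
Qed.

Lemma pr_ray_ge t : 1 / 2 <= pr P (ray t).
Proof.
have mr n : measurable (reach n t) by exact: sm (sigma_reach _ _).
have mray : measurable (ray t) by exact: sm (sigma_ray _).
have cv : P (reach n t) @[n --> \oo] --> P (ray t).
  apply: nonincreasing_cvg_mu => //.
    by rewrite ltey_eq fin_num_measure.
  apply/nonincreasing_seqP => n; apply/subsetPset; exact: reach_decr.
rewrite -lee_fin -prE //; apply: cvge_ge cv; apply: nearW => n.
by rewrite prE // lee_fin pr_reach_ge.
Qed.

(* Words are read from the right: the head of [spine k] is the last step taken,
   and all words below [spine k] have their first [true] step at index [k]. *)
Definition spine k : seq bool := true :: nseq k false.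

Definition branch k : set (seq bool) := [set s | index true (rev s) = k].

Lemma below_spine k : below (spine k) `<=` branch k.
Proof.
move=> s [u [b ->]]; rewrite /branch /= rev_cat !rev_cons rev_nseq.
rewrite !cat_rcons index_cat mem_nseq andbF size_nseq /=.
by rewrite addn0.
Qed.

(** The edge to the [false] child of [spine k] is closed, and both its endpoints start open rays
    avoiding it: the child downwards, [spine k] through its open [true] edge. *)
Definition good k : set T :=
  (~` B (false :: spine k) `&` ray (false :: spine k)) `&`
  (B (true :: spine k) `&` ray (true :: spine k)).

Lemma sigma_ray_subtree t : sigma B (subtree t) (ray t).
Proof.
by apply: (sigmaS (sigma_ray t)) => s [u [b ->]]; exists (u ++ [:: b]); rewrite -catA.
Qed.

Lemma sigma_self t : sigma B (subtree t) (B t).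
Proof. by apply: sigma_base; exists [::]. Qed.

Lemma sigma_good k : sigma B (branch k) (good k).
Proof.
apply: (sigmaS _ (@below_spine k)); apply: sigmaI;
  apply: (sigmaS _ (@below_subtree _ _)); apply: sigmaI;
  try exact: sigma_ray_subtree; last exact: sigma_self.
by apply: sigmaC; exact: sigma_self.
Qed.

(** Four independent events: a closed edge, an open edge, and two rays of probability at least [1/2]
    each. *)
Lemma pr_good_ge k : (1 - q) * q / 4 <= pr P (good k).
Proof.
have I1 t E : sigma B [set t] E -> pr P (E `&` ray t) = pr P E * pr P (ray t).
  move=> tE; apply: (@sigma_indep _ _ _ P _ B mB B_indep [set t] (below t)) => //.
    by move=> s -> /self_notin_below.
  exact: sigma_ray.
have self t : sigma B [set t] (B t) by exact: sigma_base.
rewrite (@sigma_indep _ _ _ P _ B mB B_indep _ _ _ _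
  (@subtree_disjoint false (spine k))); first last.
- by apply: sigmaI; [exact: sigma_self|exact: sigma_ray_subtree].
- by apply: sigmaI; [apply: sigmaC; exact: sigma_self|exact: sigma_ray_subtree].
rewrite !I1; [|exact: self|by apply: sigmaC; exact: self].
rewrite prC // !prB.
have := pr_ray_ge (false :: spine k); have := pr_ray_ge (true :: spine k).
set x := pr P (ray _); set y := pr P (ray _) => hx hy.
have [q_ge' q_lt1'] := (q_ge, q_lt1).
have -> : (1 - q) * q / 4 = ((1 - q) * (1 / 2)) * (q * (1 / 2)) by field.
by apply: ler_pM; [nra|nra|apply: ler_wpM2l; lra|apply: ler_wpM2l; lra].
Qed.

(** * Infinitely many good branches *)

Definition all_bad N m : set T :=
  [set w | forall k, (N <= k < N + m)%N -> ~ good k w].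

Lemma all_badS N m : all_bad N m.+1 = all_bad N m `&` ~` good (N + m)%N.
Proof.
apply/seteqP; split=> w /= H.
  split=> [k /andP[Nk kN]|]; apply: H.
    by rewrite Nk addnS ltnS ltnW.
  by rewrite leq_addr addnS ltnSn.
move=> k /andP[Nk]; rewrite addnS ltnS leq_eqVlt => /orP[/eqP ->|kN].
  exact: H.2.
by apply: H.1; rewrite Nk.
Qed.

Lemma sigma_all_bad N m :
  sigma B [set s | (index true (rev s) < N + m)%N] (all_bad N m).
Proof.
elim: m => [|m IH].
  rewrite (_ : all_bad N 0 = ~` set0).
    by apply: sigmaC; exact: sigma_algebra0.
  rewrite setC0; apply/seteqP; split=> // w _ k.
  by rewrite addn0 ltnNge; case: (N <= k)%N.
rewrite all_badS; apply: sigmaI.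
  by apply: (sigmaS IH) => s /=; rewrite addnS ltnS => /ltnW.
by apply: sigmaC; apply: (sigmaS (sigma_good _)) => s /= ->; rewrite addnS.
Qed.

(** Branches are disjoint, so each further index brings an independent factor. *)
Lemma pr_all_bad_le N m : pr P (all_bad N m) <= (1 - (1 - q) * q / 4) ^+ m.
Proof.
elim: m => [|m IH].
  by rewrite expr0; apply/pr_le1/(sm _ _ (sigma_all_bad _ _)).
rewrite all_badS (@sigma_indep _ _ _ P _ B mB B_indep _ (branch (N + m)) _ _ _
  (sigma_all_bad N m)); first last.
- by apply: sigmaC; exact: sigma_good.
- by move=> s /= + sE; rewrite sE ltnn.
rewrite prC; last exact: sm (sigma_good _).
rewrite exprSr; apply: ler_pM => //; first exact: pr_ge0.
  by rewrite subr_ge0; apply/pr_le1/(sm _ _ (sigma_good _)).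
by rewrite lerD2l lerN2 pr_good_ge.
Qed.

Lemma infinitely_many_good : {ae P, forall w, infinite_set [set k | good k w]}.
Proof.
apply: (@negligibleS _ _ _ P (\bigcup_N \bigcap_m all_bad N m)).
  move=> w /=; rewrite notK => -/finite_fsetP[X XE].
  (* Beyond the largest good index every window is bad. *)
  exists (\max_(x <- X) x).+1 => // m _ k /andP[Nk _] gk.
  have kX : k \in X by have : [set` X] k by rewrite -XE.
  have : (k <= \max_(x <- X) x)%N by exact: (leq_bigmax_seq k).
  by rewrite leqNgt Nk.
apply: negligible_bigcup => N.
have mbad m : measurable (all_bad N m) by exact: sm (sigma_all_bad _ _).
have mZ : measurable (\bigcap_m all_bad N m) by exact: bigcapT_measurable.
apply/negligibleP => //; apply: etrans (prE P mZ) _; congr (_%:E); apply/eqP.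
rewrite eq_le pr_ge0 andbT.
have : (1 - (1 - q) * q / 4) ^+ m @[m --> \oo] --> (0 : R).
  have [q_ge' q_lt1'] := (q_ge, q_lt1).
  by apply: cvg_expr; rewrite ger0_norm; nra.
move=> cv; apply: cvgr_to_ge cv _; apply: nearW => m.
apply: le_trans (pr_all_bad_le N m); apply: pr_le => //.
exact: bigcap_inf.
Qed.

End BinaryPercolation.

(** * The threshold, and the conclusion *)

(** Continuity of the distribution function at [0] gives a small interval around [0] mass at most
    [1/4]; full support makes that mass positive. *)
Lemma law_threshold (R : realType) (mu : probability (measurableTypeR R) R) :
  continuous_law mu -> law_support mu = [set: R] ->
  exists a : R, [/\ 0 < a, measurable [set x : R | a <= `|x|],
    3 / 4 <= pr mu [set x : R | a <= `|x|] & pr mu [set x : R | a <= `|x|] < 1].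
Proof.
move=> muc musupp.
have mI (i : interval R) : measurable ([set` i] : set (measurableTypeR R)).
  exact: measurable_itv.
pose F r := pr mu `]-oo, r].
have Fc : F r @[r --> (0 : R)] --> F 0.
  by apply: fine_cvg; rewrite -prE //; exact: muc.
have /nbhs_ballP [e /= e0 eF] : nbhs (0 : R) [set r | `|F 0 - F r| < 1 / 8].
  by move/cvgrPdist_lt: Fc; apply; lra.
have e2 : 0 < e / 2 by lra.
(* Halving puts both endpoints inside the ball; each differs from [F 0] by less than [1/8], hence
   the total [1/4]. *)
exists (e / 2).
have E : [set x : R | e / 2 <= `|x|] = ~` `]- (e / 2), e / 2[%classic.
  apply/seteqP; split=> x /=; rewrite in_itv /= -ltr_norml.
    by rewrite leNgt => /negP.
  by move/negP; rewrite -leNgt.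
rewrite E; split=> //; first by apply: measurableC; exact: mI.
- have F1 : `|F 0 - F (e / 2)| < 1 / 8.
    by apply: eF; rewrite /ball /= sub0r normrN gtr0_norm //; lra.
  have F2 : `|F 0 - F (- (e / 2))| < 1 / 8.
    by apply: eF; rewrite /ball /= sub0r opprK gtr0_norm //; lra.
  have : F (- (e / 2)) + pr mu `]- (e / 2), e / 2[ <= F (e / 2).
    rewrite -lee_fin EFinD -!prE //.
    rewrite -measureU //.
      apply: le_measure; rewrite ?inE //; first exact: measurableU.
      by move=> x /= []; rewrite !in_itv /= => h; [|case/andP: h]; lra.
    apply/seteqP; split=> // x /= []; rewrite !in_itv /= => h /andP[h' _].
    by move: (lt_le_trans h' h); rewrite ltxx.
  rewrite prC //; move: F1 F2; rewrite !ltr_norml.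
  move: (pr mu _) (F 0) (F _) (F (- _)) => p f g h /andP[h1 h2] /andP[h3 h4] h5.
  lra.
- rewrite prC // ltrBlDr ltrDl -lte_fin -prE //.
  have : law_support mu 0 by rewrite musupp.
  apply; first exact: itv_open.
  by rewrite /= in_itv /=; lra.
Qed.

(** A set [C] cut by the closed edge contains [v (false :: t)], whose ray leaves [C], or else [v t];
    then the [true] edge crosses the boundary or the ray beyond it does. *)
Lemma good_ground_state (R : realType) (V : choiceType) (adj : rel V)
    (j : edge adj -> R) (a : R) (v : seq bool -> V) (ve : seq bool -> edge adj)
    (t : seq bool) :
  is_tree adj -> injective v ->
  (forall b s, val (ve (b :: s)) = [fset v s; v (b :: s)]%fset) ->
  let op s := a <= `|j (ve s)| in
  ~ op (false :: t) -> op (true :: t) ->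
  (forall n, reaches op n (false :: t)) -> (forall n, reaches op n (true :: t)) ->
  exists2 s, ground_state j s & unsatisfied_only j (ve (false :: t)) s.
Proof.
move=> tree vinj veE op /negP; rewrite -ltNge => cl opt rf rt.
have [s [conf uns]] := unsatisfied_only_exists tree j (ve (false :: t)).
exists s => //; apply: (unsatisfied_only_ground_state tree conf uns) => C bC.
suff [b [u [bu uC buC]]] :
    exists b u, [/\ op (b :: u), v u \in C & v (b :: u) \notin C].
  exists (ve (b :: u)); first by exists (v u), (v (b :: u)).
  rewrite (lt_le_trans cl bu) andbT; apply: contraTneq bu; rewrite /op => ->.
  by rewrite -ltNge.
have [fC|fC] := boolP (v (false :: t) \in C); first exact: reaches_exit fC rf.
have tC : v t \in C.
  case: bC => x [y [/esym xyE xC _]]; move: (fset21 x y).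
  by rewrite xyE veE !inE => /orP[/eqP <-|/eqP xf] //; rewrite -xf xC in fC.
have [ttC|ttC] := boolP (v (true :: t) \in C); first exact: reaches_exit ttC rt.
by exists true, t.
Qed.

Theorem theorem32 (R : realType) (d : nat) (V : choiceType) (adj : rel V)
  (dT : measure_display) (T : measurableType dT) (P : probability T R)
  (J : edge adj -> {RV P >-> R}) (mu : probability (measurableTypeR R) R) :
  (3 <= d)%N ->
  is_tree adj -> regular d adj ->
  iid_with_law J mu ->
  symmetric_law mu -> continuous_law mu -> law_support mu = [set: R] ->
  {ae P, forall w : T, infinite_set (ground_state_pairs (fun e => J e w))}.
Proof.
move=> d3 tree reg [Jind Jlaw] _ muc musupp.
have [a [a0 mA A34 A1]] := law_threshold R mu muc musupp.
set A := [set x : R | a <= `|x|] in mA A34 A1.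
have [v [ve [vinj veinj _ veE]]] := binary_subtree_edges tree d3 reg.
pose B s : set T := J (ve s) @^-1` A.
have mB s : measurable (B s).
  by rewrite -[B s]setTI; exact: (measurable_funPT (J (ve s))).
have prB s : pr P (B s) = pr mu A by rewrite /pr -(Jlaw (ve s)).
have Bind (S : {fset seq bool}) :
    pr P (\bigcap_(s in [set` S]) B s) = \prod_(s <- S) pr P (B s).
  (* Independence of the couplings is pulled back to words along the injective [ve]. *)
  have := Jind [fset ve s | s in S]%fset (fun=> A) (fun=> mA).
  rewrite big_imfset /=; last by move=> ? ? _ _; exact: veinj.
  rewrite (_ : \bigcap_(i in _) _ = \bigcap_(s in [set` S]) B s); last first.
    apply/seteqP; split=> w H.
      by move=> s sS; apply: (H (ve s)); apply/imfsetP; exists s.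
    by move=> e /imfsetP[s sS ->]; exact: H.
  under eq_bigr do rewrite -[J _ @^-1` A]/(B _) prE //.
  by rewrite prodEFin => /(congr1 fine).
have Hae := infinitely_many_good R dT T P B (pr mu A) mB Bind prB A34 A1.
have inj_e : injective (fun k => ve (false :: spine k)).
  by move=> k l /veinj [/(congr1 size)]; rewrite !size_nseq.
move: Hae; apply: filterS => w Kinf.
apply: (infinite_ground_state_pairs Kinf inj_e) => k [[kf rf] [kt rt]].
apply: (good_ground_state R V adj _ a v) => // n.
- exact: rf.
- exact: rt.
Qed.
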